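(* Let $(S,\rho)$ be a complete separable metric space and let $X_n$, $X_n^{(m)}$ and $X^{(m)}$, $n,m\ge 1$, be $S$-valued random variables satisfying $$X_n^{(m)}\to X^{(m)}\ \text{in distribution as } n\to\infty,\quad\text{for every } m,$$ and $$\lim_{m\to\infty}\limsup_{n\to\infty}P(\rho(X_n,X_n^{(m)})\ge\varepsilon)=0\quad\text{for every }\varepsilon>0.$$ Then there exists an $S$-valued random variable $X$ such that $X_n\to X$ in distribution as $n\to\infty$. Moreover $X^{(m)}\to X$ in distribution as $m\to\infty$.
   Context: Convergence in distribution of $S$-valued random variables means weak convergence of their laws as Borel probability measures on $S$. For each $n$ and $m$, the variables $X_n$ and $X_n^{(m)}$ are defined on a common probability space, so that $\rho(X_n,X_n^{(m)})$ makes sense. *)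

(* Defs.v *)
(* MathComp-Analysis *)
From HB Require Import structures.
From mathcomp Require Import all_boot all_order all_algebra.
From mathcomp Require Import all_classical all_reals all_analysis.

Set Implicit Arguments.
Unset Strict Implicit.
Unset Printing Implicit Defensive.

Import Order.TTheory GRing.Theory Num.Theory.
Import numFieldNormedType.Exports.

Local Open Scope classical_set_scope.
Local Open Scope ring_scope.

(* As for the library's completeType and measurableType, the carrier is
   pointed. Nothing is lost: a space carrying a random variable is nonempty. *)
#[short(type="completeMetricType")]
HB.structure Definition CompleteMetric (R : numDomainType) :=
  { T of CompletePseudoMetric R T & PseudoMetric_isMetric R T }.

Definition separable (T : topologicalType) : Prop :=
  exists2 D : set T, countable D & dense D.

(* An alias of T, so elements of [borel T] are elements of T. *)
Notation borel T := (g_sigma_algebraType (@open T)).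

Definition weak_cvg (R : realType) (S : completeMetricType R)
    (mu : nat -> probability (borel S) R) (nu : probability (borel S) R) : Prop :=
  forall f : S -> R, continuous f -> bounded_fun f ->
    (\int[mu n]_x (f x)%:E)%E @[n --> \oo] --> (\int[nu]_x (f x)%:E)%E.

(* Each variable may live on its own probability space. *)
Definition cvg_in_distribution (R : realType) (S : completeMetricType R)
    (d : nat -> measure_display) (T : forall n, measurableType (d n))
    (P : forall n, probability (T n) R)
    (X : forall n, {RV (P n) >-> borel S})
    (d' : measure_display) (T' : measurableType d')
    (P' : probability T' R) (Y : {RV P' >-> borel S}) : Prop :=
  weak_cvg (fun n => distribution (P n) (X n)) (distribution P' Y).

(* Main.v *)
Require Import Defs.
From HB Require Import structures.
From mathcomp Require Import all_boot all_order all_algebra.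
From mathcomp Require Import all_classical all_reals all_analysis.
From mathcomp Require Import measurable_realfun lra ring.

Set Implicit Arguments.
Unset Strict Implicit.
Unset Printing Implicit Defensive.

Import Order.TTheory GRing.Theory Num.Theory.
Import numFieldNormedType.Exports.

Local Open Scope classical_set_scope.
Local Open Scope ring_scope.

(** Why the theorem is true.

The limit X is built by hand, as a function of a uniform point of [0, 1[, in
the manner of Skorokhod's representation theorem.

Fix a dense sequence x. The hypotheses make the laws of the X_n uniformly
small outside finitely many balls of any given radius (X_tight): for one good
m, the limit law of X^(m) is carried up to epsilon by finitely many balls
around the points x_i, convergence in distribution passes this to X_n^(m) for
large n, and closeness passes it to X_n.

At depth k, cut S into the disjoint pieces of the balls of radius 1/(k+1)
around the x_i; intersecting the pieces of successive depths gives a tree of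
cells indexed by words over nat. Along an ultrafilter U on the indices n, the
probability that X_n lies in a given cell always has a limit p s. These limits
are the masses of a probability tree: finite additivity is immediate, and no
mass escapes to infinitely many children precisely because of tightness. Such
a tree of masses is realised by nested intervals of length p s in [0, 1[
(probability_tree_itv), and a point t of [0, 1[ selects an infinite branch. The
centres of the balls along that branch form a Cauchy sequence, since cells of
positive mass are nonempty, and completeness gives a limit Y t (tree_variable).

For a bounded Lipschitz f, both E f(X_n) and E f(Y) are close to the finite sum
of f(centre) * mass over cells of one depth (dist_mean_sum_le), and these sums
converge along U. Hence E f(X_n) tends to E f(Y) along U (tight_ultralimit).

Finally closeness removes the ultrafilter: |E f(X_n) - E f(X_n^(m))| is small
for m large and then n large (means_close). Passing to the limit along U shows
E f(X^(m)) -> E f(Y), and going back through X_n^(m) shows E f(X_n) -> E f(Y).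
Lipschitz test functions suffice for weak convergence, because a bounded
continuous function is an increasing limit of Lipschitz ones, its
inf-convolutions with multiples of the distance (weak_cvg_lipschitz). *)

(** * Metric spaces, Borel measurability and bounded means *)

Section metric.
Context {R : realType} {S : metricType R}.
Implicit Types (x y z : S) (f : S -> R).

Definition bounded_by f (M : R) := forall x, `|f x| <= M.

Definition lipschitz_by f (L : R) := forall x y, `|f x - f y| <= L * mdist x y.

Lemma lipschitz_by_continuous f L : lipschitz_by f L -> continuous f.
Proof.
move=> fL x; apply/cvgrPdist_lt => e e0.
have L1 : 0 < `|L| + 1 by rewrite ltr_wpDl.
near=> y.
have xy : mdist x y < e / (`|L| + 1).
  suff : ball x (e / (`|L| + 1)) y by rewrite ballEmdist.
  by near: y; apply: nbhsx_ballx; rewrite divr_gt0.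
rewrite (le_lt_trans (fL x y))//.
rewrite ltr_pdivlMr// mulrC in xy.
apply: le_lt_trans xy; rewrite ler_wpM2r ?mdist_ge0//.
by rewrite (le_trans (ler_norm _))// lerDl.
Unshelve. all: by end_near. Qed.

Lemma mdist_lipschitz x : lipschitz_by (mdist x) 1.
Proof.
move=> y z; rewrite mul1r ler_norml; apply/andP; split.
- rewrite lerNl opprB lerBlDr addrC; exact: metric_triangle.
- by rewrite lerBlDr addrC (metric_sym y z); exact: metric_triangle.
Qed.

Lemma mdist_continuous x : continuous (mdist x).
Proof. exact: lipschitz_by_continuous (mdist_lipschitz x). Qed.

Lemma open_mdist_lt x r : open [set y | mdist x y < r].
Proof.
rewrite (_ : [set y | _] = mdist x @^-1` [set t | t < r])//.
by apply: open_comp => [y _|]; [exact: mdist_continuous|exact: open_lt].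
Qed.

End metric.

Section borel_measurability.
Context {R : realType} {S : completeMetricType R}.

Lemma open_borel (A : set S) : open A -> measurable (A : set (borel S)).
Proof. by move=> oA; exact: sub_sigma_algebra. Qed.

Lemma continuous_borel (f : S -> R) :
  continuous f -> measurable_fun [set: borel S] (f : borel S -> R).
Proof.
move=> cf; apply: (measurability _ (RGenOpens.measurableE R)).
move=> _ [_ [a [b ->]] <-]; rewrite setTI; apply: open_borel.
by apply: open_comp => [x _|]; [exact: cf|exact: itv_open].
Qed.

Lemma measurable_borel d (T : measurableType d) (X : T -> S) :
  (forall A : set S, open A -> measurable (X @^-1` A)) ->
  measurable_fun [set: T] (X : T -> borel S).
Proof.
move=> XA; apply: (@measurability _ _ T (borel S) _ _ (@open S)) => //.
by move=> _ [A oA <-]; rewrite setTI; exact: XA.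
Qed.

End borel_measurability.

Section bounded_means.
Context {R : realType} {d} {T : measurableType d} (P : probability T R).
Implicit Types (f g : T -> R) (A : set T) (M a b : R).

Lemma bounded_by_integrable f M : measurable_fun [set: T] f ->
  (forall w, `|f w| <= M) -> P.-integrable [set: T] (EFin \o f).
Proof.
move=> mf fM; apply: measurable_bounded_integrable => //.
- by rewrite [X in (X < _)%E]probability_setT ltry.
- exists M; split; first by rewrite num_real.
  by move=> x Mx w _; exact: le_trans (fM w) (ltW Mx).
Qed.

Lemma fine_probability_setC A : measurable A ->
  fine (P (~` A)) = 1 - fine (P A).
Proof. by move=> mA; rewrite probability_setC// fineB// fin_num_measure. Qed.

Lemma integrable_indicator A : measurable A ->
  P.-integrable [set: T] (EFin \o (\1_A : T -> R)).
Proof.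
move=> mA; apply: (@bounded_by_integrable _ 1); first exact: measurable_indic.
by move=> w; rewrite indicE; case: (_ \in _); rewrite ?normr1 ?normr0.
Qed.

Lemma Rintegral_indicator A : measurable A ->
  \int[P]_w (\1_A w : R) = fine (P A).
Proof. by move=> mA; rewrite /Rintegral integral_indic// setIT. Qed.

Lemma Rintegral_constant (c : R) : \int[P]_w c = c.
Proof. by rewrite Rintegral_cst//= [X in fine X]probability_setT mulr1. Qed.

(** The form in which means are compared: a pointwise bound that is small except
    on an event of small probability. *)
Lemma le_dist_mean f g M a b A : measurable A ->
    measurable_fun [set: T] f -> measurable_fun [set: T] g ->
    (forall w, `|f w| <= M) -> (forall w, `|g w| <= M) ->
    (forall w, `|f w - g w| <= a + b * \1_A w) ->
  `|\int[P]_w f w - \int[P]_w g w| <= a + b * fine (P A).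
Proof.
move=> mA mf mg fM gM fg.
have iF := bounded_by_integrable mf fM.
have iG := bounded_by_integrable mg gM.
rewrite -RintegralB//.
have iFG : P.-integrable [set: T] (EFin \o (fun w => f w - g w)).
  apply: (@bounded_by_integrable _ (M + M)); first exact: measurable_funB.
  by move=> w; rewrite (le_trans (ler_normB _ _))// lerD.
have iA := integrable_indicator mA.
have ibA : P.-integrable [set: T] (EFin \o (fun w => b * \1_A w)).
  exact: (integrableZl measurableT b iA).
have ia : P.-integrable [set: T] (EFin \o (fun=> a)).
  exact: (@bounded_by_integrable _ `|a|).
rewrite (le_trans (le_normr_Rintegral measurableT iFG))//.
have -> : a + b * fine (P A) = \int[P]_w (a + b * \1_A w).
  by rewrite RintegralD// Rintegral_constant RintegralZl// Rintegral_indicator.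
apply: le_Rintegral => //.
- exact: integrable_norm.
- exact: (integrableD measurableT ia ibA).
Qed.

End bounded_means.

(** * Comparing laws by a coupling or by finitely many cells *)

Section dense_sequences.
Context {R : realType} {S : completeMetricType R}.

Definition dense_seq (x : nat -> S) :=
  forall y e, 0 < e -> exists i, mdist (x i) y < e.

Lemma separable_dense_seq : separable S -> exists x, dense_seq x.
Proof.
move=> [D /countable_injP[g ginj] dD].
exists (fun n => xget point [set x | D x /\ g x = n]) => y e e0.
have [z [/= zy Dz]] := dD _ (ex_intro _ y
  (eq_ind_r (fun t => t < e) e0 (mdistxx y) : [set z | mdist y z < e] y))
  (open_mdist_lt y e).
exists (g z); case: xgetP => [t -> [Dt /ginj]|/(_ z)[]//].
by rewrite !inE => /(_ Dt Dz) ->; rewrite metric_sym.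
Qed.

(** Separability enters here: mdist (X w) (Y w) < e is witnessed by a point of a
    countable dense set near X w, which reduces it to countably many conditions
    on X alone and Y alone. *)
Lemma measurable_mdist_le d (T : measurableType d) (X Y : T -> S) (e : R) :
    separable S ->
    measurable_fun [set: T] (X : T -> borel S) ->
    measurable_fun [set: T] (Y : T -> borel S) ->
  measurable [set w | e <= mdist (X w) (Y w)].
Proof.
move=> /separable_dense_seq[x xd] mX mY.
have mpre (Z : T -> S) i r : measurable_fun [set: T] (Z : T -> borel S) ->
    measurable [set w | mdist (x i) (Z w) < r].
  move=> mZ; rewrite -[X in measurable X]setTI.
  apply: (mZ measurableT [set z | mdist (x i) z < r]).
  by apply: open_borel; exact: open_mdist_lt.
rewrite (_ : [set w | _] = ~` \bigcup_i \bigcup_k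
    ([set w | mdist (x i) (X w) < k.+1%:R^-1] `&`
     [set w | mdist (x i) (Y w) < e - k.+1%:R^-1])).
  by apply: measurableC; do 2 apply: bigcupT_measurable => ?;
     apply: measurableI; exact: mpre.
apply/seteqP; split => [w /= ew [i _ [k _ [/= xX xY]]]|w /=].
  move: ew; rewrite leNgt => /negP; apply.
  rewrite (le_lt_trans (metric_triangle _ (x i) _))// (metric_sym (X w)).
  by rewrite -[ltRHS](subrK k.+1%:R^-1) addrC ltrD.
move=> h; rewrite leNgt; apply/negP => XYe; apply: h.
have d0 : 0 < (e - mdist (X w) (Y w)) / 2 by rewrite divr_gt0// subr_gt0.
have [k kd] := ltr_add_invr d0; rewrite add0r in kd.
have [|i xi] := xd (X w) k.+1%:R^-1; first by [].
exists i => //; exists k => //; split => //=.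
rewrite (le_lt_trans (metric_triangle _ (X w) _))// ltrBrDl.
move: xi kd; set a := mdist (x i) _; set b := mdist _ _; set c := _^-1 => xi.
rewrite ltr_pdivlMr// => kd; rewrite mulr_natr mulr2n in kd; rewrite addrA.
by rewrite -ltrBrDr (lt_trans _ kd)// ltrD2l.
Qed.

End dense_sequences.

Section laws.
Context {R : realType} {S : completeMetricType R}.
Context {d} {T : measurableType d} {P : probability T R}.
Implicit Types (f : S -> R).

Lemma integral_law (X : {RV P >-> borel S}) f M :
    continuous f -> bounded_by f M ->
  (\int[distribution P X]_x (f x)%:E = (\int[P]_w f (X w))%:E)%E.
Proof.
move=> cf fM; have mf := continuous_borel cf.
have iX : P.-integrable [set: T] (EFin \o (f \o X)).
  apply: (@bounded_by_integrable _ _ _ _ _ M) => [|w]; last exact: fM.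
  exact: measurableT_comp.
rewrite (integral_distribution (f := fun x : borel S => (f x)%:E))//; last first.
  exact/measurable_EFinP.
by rewrite /Rintegral fineK//; exact: integrable_fin_num.
Qed.

(** Where X and Y are e-close, f moves by at most L * e; elsewhere, by at most
    M + M. *)
Lemma dist_mean_le (X Y : {RV P >-> borel S}) f (L M e : R) :
    separable S -> 0 <= L -> 0 <= M -> 0 < e ->
    lipschitz_by f L -> bounded_by f M ->
  `|\int[P]_w f (X w) - \int[P]_w f (Y w)| <=
  L * e + (M + M) * fine (P [set w | e <= mdist (X w : S) (Y w : S)]).
Proof.
move=> sepS L0 M0 e0 fL fM.
have mf : measurable_fun [set: borel S] (f : borel S -> R).
  exact: continuous_borel (lipschitz_by_continuous fL).
have mfZ (Z : {RV P >-> borel S}) : measurable_fun [set: T] (f \o Z).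
  exact: measurableT_comp.
apply: (@le_dist_mean _ _ _ _ _ _ M).
- by apply: measurable_mdist_le.
- exact: mfZ.
- exact: mfZ.
- by move=> w; exact: fM.
- by move=> w; exact: fM.
move=> w; rewrite indicE; have [XYe|] := leP e (mdist (X w : S) (Y w : S)).
- rewrite mem_set// mulr1 (le_trans (ler_normB _ _))//.
  by rewrite -[leLHS]add0r lerD// ?mulr_ge0 ?(ltW e0)// lerD.
- move=> XYe; rewrite memNset/= ?mulr0 ?addr0; last by apply/negP; rewrite -ltNge.
  by rewrite (le_trans (fL _ _))// ler_wpM2l// ltW.
Qed.

(** Discretisation: on the disjoint events E i, replace X by the point x i. The
    right-hand side tends to 0 when the events are fine and exhaust the mass,
    and it involves the law of X only through the masses of the E i. *)
Lemma dist_mean_sum_le (I : choiceType) (r : seq I) (E : I -> set T) (x : I -> S)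
    (X : {RV P >-> borel S}) f (L M e : R) :
    uniq r -> (forall i, measurable (E i)) ->
    (forall i j, i \in r -> j \in r -> E i `&` E j !=set0 -> i = j) ->
    0 <= L -> 0 <= M -> 0 <= e ->
    (forall i w, i \in r -> E i w -> mdist (X w : S) (x i) <= e) ->
    lipschitz_by f L -> bounded_by f M ->
  `|\int[P]_w f (X w) - \sum_(i <- r) f (x i) * fine (P (E i))| <=
  L * e + M * (1 - \sum_(i <- r) fine (P (E i))).
Proof.
move=> ur mE Edisj L0 M0 e0 Xx fL fM.
have mf : measurable_fun [set: borel S] (f : borel S -> R).
  exact: continuous_borel (lipschitz_by_continuous fL).
have mfZ (Z : {RV P >-> borel S}) : measurable_fun [set: T] (f \o Z).
  exact: measurableT_comp.
pose h c (w : T) : R := \sum_(i <- r) c i * \1_(E i) w.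
have mh c : measurable_fun [set: T] (h c).
  by apply: measurable_sum => i; apply: measurable_funM => //;
    exact: measurable_indic.
have hE c i w : i \in r -> E i w -> h c w = c i.
  move=> ir Ei; rewrite /h (big_rem i)//= [X in _ + X]big1_seq => [|j].
    by rewrite indicE mem_set// mulr1 addr0.
  rewrite mem_rem_uniq// !inE/= => /andP[/eqP ji jr].
  rewrite indicE memNset ?mulr0// => Ej.
  by apply: ji; apply: Edisj => //; exists w.
have h0 c w : (forall i, i \in r -> ~ E i w) -> h c w = 0.
  move=> nE; rewrite /h big1_seq// => i /andP[_ /nE ?].
  by rewrite indicE memNset ?mulr0.
have hI c : \int[P]_w h c w = \sum_(i <- r) c i * fine (P (E i)).
  rewrite /h; elim: (r) => [|i s IH].
    by under eq_Rintegral do rewrite big_nil; rewrite big_nil Rintegral_constant.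
  under eq_Rintegral do rewrite big_cons.
  have iE j : P.-integrable [set: T] (EFin \o (fun w => c j * \1_(E j) w)).
    exact: (integrableZl measurableT _ (integrable_indicator _ (mE j))).
  have iS : P.-integrable [set: T]
      (EFin \o (fun w => \sum_(j <- s) c j * \1_(E j) w)).
    rewrite (_ : _ \o _ = (fun w => \sum_(j <- s) (c j * \1_(E j) w)%:E)%E).
      by apply: integrable_sum => // j _; exact: iE.
    by apply/funext => w /=; rewrite sumEFin.
  rewrite (RintegralD measurableT (iE i) iS) IH big_cons.
  by rewrite RintegralZl ?Rintegral_indicator//; exact: integrable_indicator.
have mU : measurable (\big[setU/set0]_(i <- r) E i) by apply: bigsetU_measurable.
have inU w : (\big[setU/set0]_(i <- r) E i) w <-> exists2 i, i \in r & E i w.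
  by rewrite -bigcup_seq; split => [[i]|[i]] /= ? ?; exists i.
rewrite -(hI (f \o x)).
rewrite (_ : 1 - _ = fine (P (~` \big[setU/set0]_(i <- r) E i))); last first.
  rewrite fine_probability_setC//; congr (_ - _).
  rewrite -Rintegral_indicator//.
  transitivity (\int[P]_w h (fun=> 1) w).
    by rewrite hI; apply: eq_bigr => i _; rewrite mul1r.
  apply: eq_Rintegral => w _; rewrite indicE.
  have [Uw|nU] := pselect ((\big[setU/set0]_(i <- r) E i) w).
    by rewrite mem_set//; have [i ir Ei] := (inU w).1 Uw; rewrite (hE _ i).
  by rewrite memNset//; apply: h0 => i ir Ei; apply: nU; apply/inU; exists i.
have hb w : `|h (f \o x) w| <= M.
  have [[i ir Ei]|nE] := pselect (exists2 i, i \in r & E i w).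
    by rewrite (hE _ i)//; exact: fM.
  by rewrite h0 ?normr0// => i ir Ei; apply: nE; exists i.
apply: (@le_dist_mean _ _ _ _ _ _ M) => //.
- exact: measurableC.
- exact: mfZ.
move=> w; rewrite indicE.
have [/inU|nU] := pselect ((\big[setU/set0]_(i <- r) E i) w); last first.
- have nE i : i \in r -> ~ E i w by move=> ir Ei; apply: nU; apply/inU; exists i.
  rewrite mem_set// h0// ?mulr1 ?subr0.
  by rewrite (le_trans (fM _))// lerDr mulr_ge0.
- move=> [i ir Ei]; rewrite memNset; last by apply; apply/inU; exists i.
  rewrite (hE _ i)// mulr0 addr0.
  by rewrite (le_trans (fL _ _))// ler_wpM2l// Xx.
Qed.

End laws.

(** * Lipschitz test functions suffice for weak convergence *)

Section inf_convolution.
Context {R : realType} {S : completeMetricType R}.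
Implicit Types (f : S -> R) (x y : S) (M k e : R).

(** For k >= 0 and f bounded below, the largest k-Lipschitz function below f. *)
Definition inf_convolution f k x := inf [set f y + k * mdist x y | y in [set: S]].

Lemma inf_convolution_le f M k x y : 0 <= k -> bounded_by f M ->
  inf_convolution f k x <= f y + k * mdist x y.
Proof.
move=> k0 fM; apply: ge_inf; last by exists y.
exists (- M) => _ [z _ <-]; rewrite -[leLHS]addr0 lerD ?mulr_ge0 ?mdist_ge0//.
by have := fM z; rewrite ler_norml => /andP[].
Qed.

Lemma inf_convolution_ge f k x c :
  (forall y, c <= f y + k * mdist x y) -> c <= inf_convolution f k x.
Proof.
move=> h; apply: lb_le_inf; first by exists (f x + k * mdist x x), x.
by move=> _ [y _ <-].
Qed.

Lemma inf_convolution_le_self f M k x : 0 <= k -> bounded_by f M ->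
  inf_convolution f k x <= f x.
Proof.
move=> k0 fM; have := inf_convolution_le x x k0 fM.
by rewrite mdistxx mulr0 addr0.
Qed.

Lemma inf_convolution_bounded f M k : 0 <= k -> bounded_by f M ->
  bounded_by (inf_convolution f k) M.
Proof.
move=> k0 fM x; rewrite ler_norml; apply/andP; split.
  apply: inf_convolution_ge => y.
  rewrite -[leLHS]addr0 lerD ?mulr_ge0 ?mdist_ge0//.
  by have := fM y; rewrite ler_norml => /andP[].
rewrite (le_trans (inf_convolution_le_self x k0 fM))//.
by have := fM x; rewrite ler_norml => /andP[].
Qed.

Lemma inf_convolution_lipschitz f M k : 0 <= k -> bounded_by f M ->
  lipschitz_by (inf_convolution f k) k.
Proof.
move=> k0 fM; have le x y :
    inf_convolution f k x - k * mdist x y <= inf_convolution f k y.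
  apply: inf_convolution_ge => z; rewrite lerBlDr.
  rewrite (le_trans (inf_convolution_le x z k0 fM))// -addrA lerD2l -mulrDr.
  by rewrite ler_wpM2l// addrC; exact: metric_triangle.
move=> x y; rewrite ler_norml; apply/andP; split.
  by have := le y x; rewrite metric_sym lerNl opprB lerBlDr addrC -lerBlDr.
by have := le x y; rewrite lerBlDr addrC -lerBlDr.
Qed.

(** Near x, f is at least f x - e by continuity; away from x, the penalty
    n * mdist x y exceeds the oscillation of f, at most M + M, once n is large. *)
Lemma inf_convolution_cvg f M x : continuous f -> bounded_by f M ->
  inf_convolution f n%:R x @[n --> \oo] --> f x.
Proof.
move=> cf fM; apply/cvgrPdist_le => e e0.
have /cvgrPdist_lt/(_ e e0)/nbhs_ballP[r /= r0 rf] := cf x.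
have M0 : 0 <= M by exact: le_trans (fM x).
near=> n.
rewrite ger0_norm ?subr_ge0; last exact: (inf_convolution_le_self x _ fM).
rewrite lerBlDr -lerBlDl; apply: inf_convolution_ge => y.
have [rxy|xyr] := leP r (mdist x y); last first.
  have /ltW : `|f x - f y| < e by apply: rf; rewrite ballEmdist.
  rewrite ler_norml => /andP[_]; rewrite lerBlDr => fxy.
  by rewrite lerBlDl (le_trans fxy)// lerD2l lerDl mulr_ge0// mdist_ge0.
have fx : f x <= M by have := fM x; rewrite ler_norml => /andP[].
have fy : - M <= f y by have := fM y; rewrite ler_norml => /andP[].
apply: (@le_trans _ _ M); first by rewrite lerBlDl (le_trans fx)// lerDr ltW.
apply: (@le_trans _ _ (- M + n%:R * r)); last by rewrite lerD// ler_wpM2l.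
rewrite -lerBlDl opprK -ler_pdivrMr//.
by near: n; exact: nbhs_infty_ger.
Unshelve. all: by end_near. Qed.

End inf_convolution.

Section lipschitz_tests.
Context {R : realType} {S : completeMetricType R}.
Implicit Types mu : nat -> probability (borel S) R.

Lemma integrable_test (nu : probability (borel S) R) (f : S -> R) M :
  continuous f -> bounded_by f M ->
  nu.-integrable [set: borel S] (EFin \o (f : borel S -> R)).
Proof.
move=> cf fM; apply: (@bounded_by_integrable _ _ (borel S) nu f M) => //.
exact: continuous_borel.
Qed.

(** Half of the portmanteau argument: f lies above a Lipschitz g with nearly the
    same nu-mean, and the means of g converge. The other half is this one applied
    to - f. *)
Lemma lipschitz_tests_lower mu (nu : probability (borel S) R) :
  (forall (f : S -> R) L M, lipschitz_by f L -> bounded_by f M ->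
    \int[mu n]_x f x @[n --> \oo] --> \int[nu]_x f x) ->
  forall (f : S -> R) M e, continuous f -> bounded_by f M -> 0 < e ->
    \forall n \near \oo, \int[nu]_x f x - e < \int[mu n]_x f x.
Proof.
move=> h f M e cf fM e0; pose g k := inf_convolution f k%:R.
have gL k : lipschitz_by (g k) k%:R by exact: inf_convolution_lipschitz fM.
have gM k : bounded_by (g k) M by exact: inf_convolution_bounded.
have gc k := lipschitz_by_continuous (gL k).
have gf : \int[nu]_x g k x @[k --> \oo] --> \int[nu]_x f x.
  apply: fine_cvg; rewrite fineK; last first.
    exact: integrable_fin_num (integrable_test _ cf fM).
  have [] := @dominated_convergence _ _ _ nu _ measurableT
    (fun k x => (g k x)%:E) (fun x => (f x)%:E) (fun=> M%:E) => //.
  - by move=> k; apply/measurable_EFinP; exact: continuous_borel.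
  - by apply/measurable_EFinP; exact: continuous_borel.
  - apply: aeW => x _; apply: cvg_EFin; first exact: nearW.
    exact: inf_convolution_cvg fM.
  - apply: (@bounded_by_integrable _ _ _ _ _ `|M|) => //.
  - by apply: aeW => x n _; rewrite lee_fin; exact: gM.
have e20 : 0 < e / 2 by rewrite divr_gt0.
have /cvgrPdist_lt/(_ _ e20)[k _ /(_ k (leqnn _)) gk] := gf.
have /cvgrPdist_lt/(_ _ e20) := h _ _ _ (gL k) (gM k).
apply: filterS => n hn.
have fg : \int[mu n]_x g k x <= \int[mu n]_x f x.
  apply: le_Rintegral => //.
  - exact: integrable_test (gM k).
  - exact: integrable_test fM.
  - by move=> x _; exact: (inf_convolution_le_self x _ fM).
move: gk hn; rewrite /= !ltr_norml => /andP[_ gk] /andP[_ hn].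
by apply: lt_le_trans fg; move: gk hn; lra.
Qed.

Lemma weak_cvg_lipschitz mu (nu : probability (borel S) R) :
  (forall (f : S -> R) L M, lipschitz_by f L -> bounded_by f M ->
    \int[mu n]_x f x @[n --> \oo] --> \int[nu]_x f x) ->
  weak_cvg mu nu.
Proof.
move=> h f cf [M [_ bM]].
have fM : bounded_by f (`|M| + 1).
  by move=> x; apply: (bM (`|M| + 1)) => //; rewrite ltr_pwDr// ler_norm.
have NfM : bounded_by (fun x => - f x) (`|M| + 1).
  by move=> x; rewrite normrN; exact: fM.
have cNf : continuous (fun x => - f x) by move=> x; apply: cvgN; exact: cf.
have E (la : probability (borel S) R) :
    (\int[la]_x (f x)%:E = (\int[la]_x f x)%:E)%E.
  by rewrite /Rintegral fineK//; exact: integrable_fin_num (integrable_test _ cf fM).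
rewrite E; under eq_fun do rewrite E.
apply: cvg_EFin; first exact: nearW.
apply/cvgrPdist_lt => e e0.
have IN (la : probability (borel S) R) : \int[la]_x (- f x) = - \int[la]_x f x.
  under eq_Rintegral do rewrite -mulN1r.
  rewrite RintegralZl//; last exact: integrable_test fM.
  by rewrite mulN1r.
have := lipschitz_tests_lower h cNf NfM e0; rewrite IN.
have := lipschitz_tests_lower h cf fM e0.
apply: filterS2 => n lo; rewrite IN => hi.
by rewrite /= ltr_norml; apply/andP; split; move: lo hi; lra.
Qed.

End lipschitz_tests.

(** * Trees of masses realised by nested intervals *)

(** A word over nat names a node of the tree, with its last letter in front: the
    children of s are the words i :: s. *)
Section mass_trees.
Context {R : realType}.
Variable p : seq nat -> R.
Hypothesis p_ge0 : forall s, 0 <= p s.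
Hypothesis p_nil : p [::] = 1.
Hypothesis p_cons : forall s,
  \sum_(i < n) p (nat_of_ord i :: s) @[n --> \oo] --> p s.

(** The intervals of the children of s are laid side by side, in order, from the
    left end of the interval of s. *)
Fixpoint left_end (s : seq nat) : R :=
  if s is i :: s' then left_end s' + \sum_(j < i) p (nat_of_ord j :: s') else 0.

Definition tree_itv s : set R := `[left_end s, left_end s + p s[%classic.

Lemma tree_itvP s t : tree_itv s t <-> left_end s <= t < left_end s + p s.
Proof. by rewrite /tree_itv /= in_itv. Qed.

Lemma tree_itv_nil : tree_itv [::] = `[0, 1[%classic.
Proof. by rewrite /tree_itv /= p_nil add0r. Qed.

Lemma partial_mass_homo s :
  {homo (fun n => \sum_(i < n) p (nat_of_ord i :: s)) : m n / (m <= n)%N >-> m <= n}.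
Proof.
move=> m n /subnKC <-; rewrite big_split_ord/= lerDl; exact: sumr_ge0.
Qed.

Lemma partial_mass_le s n : \sum_(i < n) p (nat_of_ord i :: s) <= p s.
Proof.
rewrite -(cvg_lim (@Rhausdorff R) (@p_cons s)).
apply: nondecreasing_cvgn_le => //; first exact: partial_mass_homo.
by apply/cvg_ex; exists (p s).
Qed.

Lemma tree_itv_cons s i : tree_itv (i :: s) `<=` tree_itv s.
Proof.
move=> t /tree_itvP/= /andP[lt tu]; apply/tree_itvP; apply/andP; split.
  by rewrite (le_trans _ lt)// lerDl; exact: sumr_ge0.
rewrite (lt_le_trans tu)// -addrA lerD2l.
by have := partial_mass_le s i.+1; rewrite big_ord_recr.
Qed.

(** No point of the interval of s is missed, because the masses of the children
    add up to the whole of p s. *)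
Lemma tree_itv_refine s t : tree_itv s t -> exists i, tree_itv (i :: s) t.
Proof.
move=> /tree_itvP/andP[lt tu].
pose u n := t < left_end s + \sum_(i < n) p (nat_of_ord i :: s).
have exu : exists n, u n.
  have /cvgrPdist_lt/(_ (left_end s + p s - t)) := @p_cons s.
  rewrite subr_gt0 => /(_ tu)[n _ /(_ n (leqnn n))/=].
  rewrite ltr_norml => /andP[_ h].
  by exists n; rewrite /u; move: h; lra.
(* The first n whose partial sum passes t; the child is its predecessor. *)
case: (ex_minnP exu) => -[|i] ui imin.
  by move: ui; rewrite /u big_ord0 addr0 ltNge lt.
exists i; apply/tree_itvP; apply/andP; split => /=.
  by rewrite leNgt; apply/negP => /imin; rewrite ltnn.
by move: ui; rewrite /u big_ord_recr/= addrA.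
Qed.

Lemma tree_itv_sibling s i j t :
  tree_itv (i :: s) t -> tree_itv (j :: s) t -> i = j.
Proof.
move=> /tree_itvP/= /andP[li ui] /tree_itvP/= /andP[lj uj].
have H a b : left_end s + \sum_(k < b) p (nat_of_ord k :: s) <= t ->
    t < left_end s + \sum_(k < a) p (nat_of_ord k :: s) + p (a :: s) -> (b <= a)%N.
  move=> lb ua; rewrite leqNgt; apply/negP => ab.
  have := partial_mass_homo s ab; rewrite big_ord_recr/= leNgt => /negP; apply.
  by move: lb ua; lra.
by apply/eqP; rewrite eqn_leq (H j i)//= (H i j).
Qed.

Lemma tree_itv_disjoint s s' t : size s = size s' ->
  tree_itv s t -> tree_itv s' t -> s = s'.
Proof.
elim: s s' => [|i s IH] [|j s']//= [ss'] si s'j.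
have ? : s = s'.
  by apply: IH => //; [exact: tree_itv_cons si|exact: tree_itv_cons s'j].
by subst s'; rewrite (tree_itv_sibling si s'j).
Qed.

Lemma tree_itv_cover k t : tree_itv [::] t -> exists2 s, size s = k & tree_itv s t.
Proof.
move=> t0; elim: k => [|k [s sk st]]; first by exists [::].
by have [i ist] := tree_itv_refine st; exists (i :: s) => //=; rewrite sk.
Qed.

Lemma tree_itv_sub s : tree_itv s `<=` tree_itv [::].
Proof. by elim: s => // i s IH t /tree_itv_cons/IH. Qed.

Lemma tree_itv_mass_gt0 s t : tree_itv s t -> 0 < p s.
Proof. by move=> /tree_itvP/andP[]; lra. Qed.

Lemma uniform_prob01 (A : set R) : measurable A -> A `<=` `[0, 1] ->
  uniform_prob (@ltr01 R) A = lebesgue_measure A.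
Proof.
move=> mA A01.
rewrite -[LHS](_ : (\int[uniform_prob (@ltr01 R)]_x (\1_A x)%:E)%E = _).
  rewrite integral_uniform//; last first.
  - by apply/measurable_EFinP; exact: measurable_indic.
  rewrite subr0 invr1 mul1e integral_indic//.
  by rewrite setIidl.
by rewrite integral_indic// setIT.
Qed.

Lemma measurable_tree_itv s : measurable (tree_itv s : set (measurableTypeR R)).
Proof. exact: measurable_itv. Qed.

Lemma probability_tree_itv s : fine (uniform_prob (@ltr01 R) (tree_itv s)) = p s.
Proof.
rewrite uniform_prob01; last 2 first.
- exact: measurable_itv.
- move=> t /tree_itv_sub; rewrite tree_itv_nil /= !in_itv/= => /andP[-> /ltW]//.
rewrite /tree_itv lebesgue_measure_itv/= lte_fin ltrDl.
case: ltP => [_|ps].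
  by rewrite -EFinB addrAC subrr add0r.
by apply/eqP; rewrite eq_le p_ge0 ps.
Qed.

(** Truncating the alphabet at each depth loses as little mass as desired. *)
Lemma finite_words_mass k e : 0 < e -> exists r : seq (seq nat),
  [/\ uniq r, {in r, forall s, size s = k} & 1 - e < \sum_(s <- r) p s].
Proof.
move=> e0; elim: k => [|k [r [ur rk re]]].
  exists [:: [::]]; split => // [s|]; first by rewrite inE => /eqP ->.
  by rewrite big_seq1 p_nil ltrBlDr ltrDl.
have : \sum_(s <- r) \sum_(i < n) p (nat_of_ord i :: s) @[n --> \oo] -->
    \sum_(s <- r) p s.
  by apply: (cvg_big add_continuous) => s _; exact: p_cons.
move=> /cvgrPdist_lt/(_ (\sum_(s <- r) p s - (1 - e))).
rewrite subr_gt0 => /(_ re)[n _ /(_ n (leqnn n))/=]; rewrite ltr_norml => /andP[_ h].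
exists [seq i :: s | s <- r, i <- iota 0 n]; split.
- apply: allpairs_uniq => //; first exact: iota_uniq.
  by move=> [s i] [s' i'] _ _ /= [-> ->].
- by move=> _ /allpairsP[[s i] [/= /rk <- _ ->]].
- rewrite big_allpairs_dep /=.
  under eq_bigr do rewrite -[X in iota 0 X]subn0 -/(index_iota 0 n) big_mkord.
  by move: h; lra.
Qed.

End mass_trees.

(** * The random variable selected by the branches of a tree *)

Section tree_variable.
Context {R : realType} {S : completeMetricType R}.
Variable p : seq nat -> R.
Hypothesis p_ge0 : forall s, 0 <= p s.
Hypothesis p_cons : forall s,
  \sum_(i < n) p (nat_of_ord i :: s) @[n --> \oo] --> p s.

Variables (A : seq nat -> set S) (x : nat -> S) (r : nat -> R).
Hypothesis A_cons : forall i s, A (i :: s) `<=` A s.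
Hypothesis A_neq0 : forall s, 0 < p s -> A s !=set0.
Hypothesis A_close : forall i s y, A (i :: s) y -> mdist y (x i) <= r (size s).
Hypothesis r0 : r k @[k --> \oo] --> 0.

(** The centres along the branch of t form a Cauchy sequence: the cells of two
    prefixes of the branch share a point, as the longer prefix has positive mass,
    so their centres are within r j + r k of each other. Completeness of S
    enters here. *)
Lemma tree_limit_point t : exists y, forall i s, tree_itv p (i :: s) t ->
  mdist y (x i) <= r (size s).
Proof.
have [t0|nt] := pselect (tree_itv p [::] t); last first.
  by exists point => i s /(tree_itv_sub p_ge0 p_cons).
pose a := fix a k := if k is k'.+1 then
  xget 0%N [set i | tree_itv p (i :: a k') t] :: a k' else [::].
have sa k : size (a k) = k by elim: k => //= k ->.
have ta k : tree_itv p (a k) t.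
  elim: k => //= k IH; case: xgetP => [i -> //|/= h].
  by have [i] := tree_itv_refine p_cons IH; move/h.
pose c k := head 0%N (a k.+1).
have aA j k : (k <= j)%N -> A (a j) `<=` A (a k).
  move=> /subnKC <-; elim: (j - k)%N => [|n IH]; first by rewrite addn0.
  by rewrite addnS; apply: subset_trans IH; exact: A_cons.
have close j k : (k <= j)%N -> mdist (x (c j)) (x (c k)) <= r j + r k.
  move=> kj; have [z zj] := A_neq0 (tree_itv_mass_gt0 (ta j.+1)).
  have zk : A (a k.+1) z by exact: aA zj.
  rewrite (le_trans (metric_triangle _ z _))// lerD//.
    by rewrite metric_sym; have := A_close zj; rewrite sa.
  by have := A_close zk; rewrite sa.
have /cvg_ex[/= y cy] : cvg (x (c k) @[k --> \oo]).
  apply/cauchy_cvgP/cauchy_ballP => e e0.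
  have e20 : 0 < e / 2 by rewrite divr_gt0.
  have /cvgrPdist_lt/(_ _ e20)[n _ rn] := r0.
  have {}rn k : (n <= k)%N -> r k < e / 2.
    by move=> /rn/=; rewrite sub0r normrN => /(le_lt_trans (ler_norm _)).
  pose tail := (fun k => x (c k)) @` [set k | (n <= k)%N].
  exists (tail, tail).
    by split; exists n => // k /= nk; exists k.
  move=> [u v] [[j /= nj <-] [k /= nk <-]]; rewrite /= ballEmdist/=.
  wlog kj : j k nj nk / (k <= j)%N.
    move=> h; have [kj|/ltnW jk] := leqP k j; first exact: h.
    by rewrite metric_sym; exact: h.
  by rewrite (le_lt_trans (close _ _ kj))// (splitr e) ltrD// rn.
exists y => i s ts.
have isE : i :: s = a (size s).+1.
  by apply: (tree_itv_disjoint p_ge0 p_cons _ ts (ta _)); rewrite sa.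
have -> : i = c (size s) by rewrite /c -isE.
apply/ler_addgt0Pr => e e0; have e20 : 0 < e / 2 by rewrite divr_gt0.
have /cvgrPdist_lt/(_ _ e20)[n _ rn] := r0.
have /cvg_ballP/(_ _ e20)[m _ ym] := cy.
pose j := maxn (maxn n m) (size s).
have nj : (n <= j)%N by rewrite /j !leq_max leqnn.
have mj : (m <= j)%N by rewrite /j !leq_max leqnn orbT.
have sj : (size s <= j)%N by rewrite /j leq_max leqnn orbT.
have := rn j nj; rewrite /= sub0r normrN => /(le_lt_trans (ler_norm _)) rj.
have := ym j mj; rewrite /= ballEmdist/= => yj.
rewrite (le_trans (metric_triangle _ (x (c j)) _))//.
have := close _ _ sj; move: rj yj; lra.
Qed.

(** The preimage of an open set G is, inside [0, 1[, the union of the countably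
    many intervals whose r-ball around the centre lies in G; so the pointwise
    choice of limits is measurable. *)
Lemma tree_variable : exists Y : {RV (uniform_prob (@ltr01 R)) >-> borel S},
  forall i s t, tree_itv p (i :: s) t -> mdist (Y t : S) (x i) <= r (size s).
Proof.
have [y yP] := choice tree_limit_point.
pose Y t : S := if `[< tree_itv p [::] t >] then y t else point.
have YP i s t : tree_itv p (i :: s) t -> mdist (Y t) (x i) <= r (size s).
  move=> ist; rewrite /Y; case: asboolP => [_|]; first exact: yP.
  by case; exact: (tree_itv_sub p_ge0 p_cons ist).
suff mY : measurable_fun [set: measurableTypeR R] (Y : measurableTypeR R -> borel S).
  pose mixin := isMeasurableFun.Build _ _ _ _ _ mY.
  by exists (MeasurableFun.Pack (MeasurableFun.Class mixin)).
apply: measurable_borel => G oG.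
pose inside s := if s is i :: s' then
  forall z, mdist z (x i) <= r (size s') -> G z else False.
rewrite (_ : _ @^-1` _ = (\bigcup_(s in inside) tree_itv p s) `|`
    (~` tree_itv p [::] `&` [set _ | G point])).
  apply: measurableU.
    rewrite bigcup_mkcond; apply: countable_bigcupT_measurable => // s.
    by case: ifP => // _; exact: measurable_tree_itv.
  apply: measurableI; first by apply: measurableC; exact: measurable_tree_itv.
  have [Gp|nGp] := pselect (G point).
    by rewrite (_ : mkset _ = setT)//; apply/seteqP; split.
  by rewrite (_ : mkset _ = set0)//; apply/seteqP; split.
apply/seteqP; split => [t /= Gt|t /= [[[//|i s] /= + /YP]|]]; last 2 first.
- by move=> h /h.
- by move=> [nt Gp]; rewrite /Y; case: asboolP.
have [t0|nt] := pselect (tree_itv p [::] t); last first.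
  by right; split => //; move: Gt; rewrite /Y; case: asboolP.
left; have /nbhs_ballP[e /= e0 eG] : nbhs (Y t) G by apply: open_nbhs_nbhs; split.
have e20 : 0 < e / 2 by rewrite divr_gt0.
have /cvgrPdist_lt/(_ _ e20)[n _ /(_ n (leqnn n))/=] := r0.
rewrite sub0r normrN => /(le_lt_trans (ler_norm _)) rn.
have [[//|i s] [sn] ist] := tree_itv_cover p_cons n.+1 t0.
exists (i :: s) => //= z zi; apply: eG; rewrite ballEmdist/=.
rewrite (le_lt_trans (metric_triangle _ (x i) _))// (metric_sym (x i)).
by have := YP _ _ _ ist; move: zi rn; rewrite sn; lra.
Qed.

End tree_variable.

(** * Ultralimits of tight sequences of laws *)

(** Bounded sequences converge along an ultrafilter; this replaces diagonal
    extraction over the countably many cells. *)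
Lemma ultra_bounded_cvg {R : realType} (I : Type) (U : set_system I)
    (u : I -> R) (a b : R) :
  UltraFilter U -> (forall i, a <= u i <= b) -> exists l : R, u i @[i --> U] --> l.
Proof.
move=> UF uab; have [|l [_ lc]] := @segment_compact R a b (fmap u U) _.
  by apply: nearW => i; rewrite /= in_itv/= uab.
exists l; apply/cvg_ballP => e e0.
have [//|nU] := in_ultra_setVsetC [set i | ball l e (u i)] UF.
by have [y []] := lc (~` ball l e) (ball l e) nU (nbhsx_ballx l e e0).
Qed.

Section cells.
Context {R : realType} {S : completeMetricType R}.
Variable x : nat -> S.

Definition first_balls (N : nat) (r : R) : set S :=
  [set y | exists2 i, (i < N)%N & mdist (x i) y < r].

Definition radius (k : nat) : R := k.+1%:R^-1.

(** Depth k refines the previous cells by the balls of radius 1/(k+1) around the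
    x_i, each deprived of the preceding ones. *)
Fixpoint cell (s : seq nat) : set S :=
  if s is i :: s' then
    cell s' `&` seqDU (fun j => [set y | mdist (x j) y < radius (size s')]) i
  else setT.

Lemma cell_cons i s : cell (i :: s) `<=` cell s.
Proof. by move=> y []. Qed.

Lemma cell_close i s y : cell (i :: s) y -> mdist y (x i) <= radius (size s).
Proof. by move=> [_ [/ltW]]; rewrite metric_sym. Qed.

Lemma measurable_cell s : measurable (cell s : set (borel S)).
Proof.
elim: s => [|i s IH]; first exact: measurableT.
apply: measurableI => //; apply: seqDU_measurable => j.
by apply: open_borel; exact: open_mdist_lt.
Qed.

(** The first N children of a cell miss only what lies outside N balls; this is
    what tightness controls. *)
Lemma bigsetU_cell s N :
  \big[setU/set0]_(i < N) cell (nat_of_ord i :: s) =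
  cell s `&` first_balls N (radius (size s)).
Proof.
set B := fun j => [set y | mdist (x j) y < radius (size s)].
have -> : \big[setU/set0]_(i < N) cell (nat_of_ord i :: s) =
    cell s `&` \big[setU/set0]_(i < N) seqDU B i.
  rewrite -(bigcup_mkord N (fun i => cell (i :: s))) /= -setI_bigcupr.
  by rewrite (bigcup_mkord N (seqDU B)).
by rewrite -bigsetU_seqDU -(bigcup_mkord N B).
Qed.

Lemma cell_disjoint s s' : size s = size s' -> cell s `&` cell s' !=set0 -> s = s'.
Proof.
elim: s s' => [|i s IH] [|j s']//= [ss'] [y [[ys yi] [ys' yj]]].
have ? : s = s' by apply: IH => //; exists y.
subst s'; congr (_ :: _).
have := @trivIset_seqDU _ (fun j => [set y | mdist (x j) y < radius (size s)]).
by apply => //; exists y.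
Qed.

Lemma measurable_first_balls N r : measurable (first_balls N r : set (borel S)).
Proof.
rewrite (_ : first_balls N r = \bigcup_(i < N) [set y | mdist (x i) y < r]).
  by apply: bigcup_measurable => i _; apply: open_borel; exact: open_mdist_lt.
by apply/seteqP; split => [y [i /= iN yi]|y [i /= iN yi]]; exists i.
Qed.

Lemma radius_gt0 k : 0 < radius k.
Proof. by rewrite invr_gt0. Qed.

Lemma radius_cvg0 : radius k @[k --> \oo] --> 0.
Proof. exact: cvg_harmonic. Qed.

End cells.

Lemma approximation_chain {R : realFieldType} (a b c c' u u' v e : R) :
  `|a - c| <= v + u -> `|b - c'| <= v + u' -> v <= e / 8 -> u' <= e / 8 ->
  `|u' - u| < e / 8 -> `|c' - c| < e / 8 -> `|b - a| < e.
Proof.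
rewrite !ltr_norml !ler_norml.
move=> /andP[a1 a2] /andP[a3 a4] a5 a6 /andP[a7 a8] /andP[a9 a10].
by apply/andP; split; lra.
Qed.

Section ultralimit.
Context {R : realType} {S : completeMetricType R}.
Variables (x : nat -> S) (U : set_system nat).
Hypothesis UF : UltraFilter U.
Context (d : nat -> measure_display) (T : forall n, measurableType (d n))
  (P : forall n, probability (T n) R) (X : forall n, {RV (P n) >-> borel S}).
Hypothesis tight : forall r e : R, 0 < r -> 0 < e -> exists N, \forall n \near U,
  1 - e <= fine (P n (X n @^-1` first_balls x N r)).

Let law n (A : set S) : R := fine (P n (X n @^-1` A)).

Let measurable_pre n (A : set S) :
  measurable (A : set (borel S)) -> measurable (X n @^-1` A).
Proof. by move=> mA; rewrite -[X in measurable X]setTI; exact: measurable_funPT. Qed.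

Let law_le n (A B : set S) : measurable (A : set (borel S)) ->
  measurable (B : set (borel S)) -> A `<=` B -> law n A <= law n B.
Proof.
move=> mA mB AB; apply: fine_le;
  rewrite ?fin_num_measure//; try exact: measurable_pre.
by apply: le_measure; rewrite ?inE; [exact: measurable_pre..|exact: preimage_subset].
Qed.

Let law01 n (A : set S) : measurable (A : set (borel S)) -> 0 <= law n A <= 1.
Proof.
move=> mA; rewrite /law fine_ge0//=.
rewrite -lee_fin fineK ?fin_num_measure//; last exact: measurable_pre.
by apply: probability_le1; exact: measurable_pre.
Qed.

Let law_setI n (A B : set S) : measurable (A : set (borel S)) ->
  measurable (B : set (borel S)) -> law n A + law n B - 1 <= law n (A `&` B).
Proof.
move=> mA mB.
have mAB : measurable (A `&` B : set (borel S)) by exact: measurableI.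
have mD : measurable (A `\` B : set (borel S)) by exact: measurableD.
have -> : law n A = law n (A `&` B) + law n (A `\` B).
  have mI := measurable_pre n mAB; have mP := measurable_pre n mD.
  have dis : X n @^-1` (A `&` B) `&` X n @^-1` (A `\` B) = set0.
    by apply/seteqP; split => // w [[_ ?] [_]].
  rewrite /law -fineD ?fin_num_measure// -(measureU _ mI mP dis).
  by rewrite -preimage_setU setUIDK.
have : law n (A `\` B) <= law n (~` B).
  by apply: law_le => //; exact: measurableC.
rewrite {2}/law preimage_setC fine_probability_setC; last exact: measurable_pre.
by rewrite -/(law n B); lra.
Qed.

Let law_bigcell n s N : \sum_(i < N) law n (cell x (nat_of_ord i :: s)) =
  law n (cell x s `&` first_balls x N (radius (size s))).
Proof.
rewrite -bigsetU_cell -(bigcup_mkord N (fun i => cell x (i :: s))) /law.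
rewrite preimage_bigcup (bigcup_mkord N (fun i => X n @^-1` cell x (i :: s))).
have mc i : measurable (X n @^-1` cell x (i :: s)).
  by apply: measurable_pre; exact: measurable_cell.
rewrite (measure_bigsetU _ mc) => [|i j _ _ [w [wi wj]]].
  by rewrite sum_fine// => i _; rewrite fin_num_measure.
by have [] := @cell_disjoint _ _ x (i :: s) (j :: s) erefl
  (ex_intro _ (X n w) (conj wi wj)).
Qed.

(** The masses p s are the limits along U of the probabilities of the cells.
    Tightness makes the masses of the children of s add up to p s, hence lets
    finitely many words of a given length carry nearly all the mass; the means of
    f under X n and under Y are then both read off from these words. *)
Lemma tight_ultralimit : exists Y : {RV (uniform_prob (@ltr01 R)) >-> borel S},
  forall f L M, 0 <= L -> lipschitz_by f L -> bounded_by f M ->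
  \int[P n]_w f (X n w) @[n --> U] --> \int[uniform_prob (@ltr01 R)]_t f (Y t).
Proof.
have mc := @measurable_cell R S x.
have [p pP] := choice (fun s => ultra_bounded_cvg UF (fun n => law01 n (mc s))).
have {}pP s : law n (cell x s) @[n --> U] --> p s by exact: pP.
have p_ge0 s : 0 <= p s.
  apply: (cvgr_to_ge (@pP s)); apply: nearW => n.
  by have /andP[] := law01 n (mc s).
have p_nil : p [::] = 1.
  apply: (cvg_unique (@Rhausdorff R) (@pP [::])).
  rewrite (_ : (fun n => _) = fun=> 1); first exact: cvg_cst.
  by apply/funext => n; rewrite /law /= preimage_setT probability_setT.
have psum s N : \sum_(i < N) law n (cell x (nat_of_ord i :: s)) @[n --> U] -->
    \sum_(i < N) p (nat_of_ord i :: s).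
  by apply: (cvg_big add_continuous).
have p_cons s : \sum_(i < n) p (nat_of_ord i :: s) @[n --> \oo] --> p s.
  apply/cvgrPdist_le => e e0.
  have [N UN] := tight (radius_gt0 (size s)) e0.
  exists N => // n /= Nn.
  have le : \sum_(i < n) p (nat_of_ord i :: s) <= p s.
    apply: (ler_cvg_to (psum s n) (@pP s)); apply: nearW => m.
    rewrite law_bigcell; apply: law_le => //.
    by apply: measurableI => //; exact: measurable_first_balls.
  rewrite ger0_norm ?subr_ge0// lerBlDr -lerBlDl.
  apply: (@le_trans _ _ (\sum_(i < N) p (nat_of_ord i :: s))); last first.
    exact: partial_mass_homo.
  (* The cell of s meets the complement of N balls with probability at most e. *)
  apply: (ler_cvg_to (cvgB (@pP s) (cvg_cst e)) (psum s N)).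
  apply: filterS UN => m hm; rewrite law_bigcell.
  have := law_setI m (mc s) (measurable_first_balls x N (radius (size s))).
  have {}hm : 1 - e <= law m (first_balls x N (radius (size s))) by exact: hm.
  move=> hI; change (law m (cell x s) - e <=
    law m (cell x s `&` first_balls x N (radius (size s)))).
  by move: hm hI; lra.
have A_neq0 s : 0 < p s -> cell x s !=set0.
  move=> ps; apply/set0P/eqP => c0; move: ps.
  suff -> : p s = 0 by rewrite ltxx.
  apply: (cvg_unique (@Rhausdorff R) (@pP s)).
  rewrite (_ : (fun n => _) = fun=> 0); first exact: cvg_cst.
  by apply/funext => n; rewrite /law c0 preimage_set0 measure0.
have [Y YP] := tree_variable p_ge0 p_cons (@cell_cons _ _ x) A_neq0
  (@cell_close _ _ x) (@radius_cvg0 R).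
exists Y => f L M L0 fL fM; apply/cvgrPdist_lt => e e0.
have M0 : 0 <= M by exact: le_trans (fM (x 0%N)).
have L1 : 0 < L + 1 by rewrite ltr_wpDl.
have M1 : 0 < M + 1 by rewrite ltr_wpDl.
have dL : 0 < e / (L + 1) / 8 by rewrite !divr_gt0.
have dM : 0 < e / (M + 1) / 8 by rewrite !divr_gt0.
have /cvgrPdist_lt/(_ _ dL)[k _ /(_ k (leqnn k))/=] := @radius_cvg0 R.
rewrite sub0r normrN => /(le_lt_trans (ler_norm _)) rk.
(* Words of length k + 1, as their first letter names a ball of radius k. *)
have [l [ul lk lM]] := finite_words_mass p_nil p_cons k.+1 dM.
have Lr : L * radius k <= e / 8.
  rewrite (@le_trans _ _ ((L + 1) * (e / (L + 1) / 8)))//.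
    by rewrite ler_pM ?lerDl ?invr_ge0 ?(ltW rk).
  by rewrite mulrA mulrCA divff ?mulr1// gt_eqF.
have Mm : M * (1 - \sum_(s <- l) p s) <= e / 8.
  have m0 : 1 - \sum_(s <- l) p s <= e / (M + 1) / 8 by move: lM; lra.
  rewrite (@le_trans _ _ ((M + 1) * (e / (M + 1) / 8)))//; last first.
    by rewrite mulrA mulrCA divff ?mulr1// gt_eqF.
  rewrite (@le_trans _ _ (M * (e / (M + 1) / 8)))//; first by rewrite ler_wpM2l.
  by rewrite ler_wpM2r ?lerDl ?(ltW dM).
(* The default 0 is never met: the words in l are nonempty. *)
pose y s := x (head 0%N s).
have eY : `|\int[uniform_prob (@ltr01 R)]_t f (Y t) - \sum_(s <- l) f (y s) * p s| <=
    L * radius k + M * (1 - \sum_(s <- l) p s).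
  have := @dist_mean_sum_le _ S _ _ (uniform_prob (@ltr01 R)) _ l (tree_itv p) y Y
    f L M (radius k) ul.
  under eq_bigr do rewrite probability_tree_itv//.
  under [X in _ + M * (1 - X)]eq_bigr do rewrite probability_tree_itv//.
  apply => //.
  - by move=> s; exact: measurable_tree_itv.
  - move=> s s' /lk sk /lk sk' [t [st s't]].
    by apply: (tree_itv_disjoint p_ge0 p_cons _ st s't); rewrite sk.
  - by rewrite invr_ge0.
  - move=> [|i s] t /lk //= [sk] /YP; rewrite sk; exact.
have eX n : `|\int[P n]_w f (X n w) - \sum_(s <- l) f (y s) * law n (cell x s)| <=
    L * radius k + M * (1 - \sum_(s <- l) law n (cell x s)).
  apply: (@dist_mean_sum_le _ S _ _ _ _ l (fun s => X n @^-1` cell x s) y (X n)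
    f L M (radius k) ul) => //.
  - by move=> s; exact: measurable_pre.
  - move=> s s' /lk sk /lk sk' [t [st s't]].
    by apply: (@cell_disjoint _ _ x); [rewrite sk|exists (X n t)].
  - by rewrite invr_ge0.
  - by move=> [|i s] t /lk //= [sk] /(@cell_close _ _ x i s); rewrite sk.
have c1 : \sum_(s <- l) law n (cell x s) @[n --> U] --> \sum_(s <- l) p s.
  by apply: (cvg_big add_continuous).
have c2 : \sum_(s <- l) f (y s) * law n (cell x s) @[n --> U] -->
    \sum_(s <- l) f (y s) * p s.
  by apply: (cvg_big add_continuous) => s _; apply: cvgZr.
have e8 : 0 < e / 8 by rewrite divr_gt0.
have c3 : M * (1 - \sum_(s <- l) law n (cell x s)) @[n --> U] -->
    M * (1 - \sum_(s <- l) p s).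
  by apply: cvgZr; apply: cvgB => //; exact: cvg_cst.
move/cvgrPdist_lt : c2 => /(_ _ e8); move/cvgrPdist_lt : c3 => /(_ _ e8).
apply: filterS2 => n /= h1 h2; apply: approximation_chain (eX n) eY Lr Mm h1 h2.
Qed.

End ultralimit.

(** * Tightness and comparison of means under the hypotheses of the theorem *)

Section cutoff.
Context {R : realType} {S : completeMetricType R}.
Variable x : nat -> S.
Implicit Types (N : nat) (r : R).

(** A Lipschitz function squeezed between the indicators of the complements of
    the first N balls of radius r and of radius r / 2: it vanishes on the smaller
    balls and the slope 2 / r lets it reach 1 at distance r / 2 from them. *)
Definition cutoff N r : S -> R :=
  inf_convolution (\1_(~` first_balls x N (r / 2))) (2 / r).

Let indicator_bounded (A : set S) : bounded_by (\1_A : S -> R) 1.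
Proof. by move=> y; rewrite indicE; case: (_ \in _); rewrite ?normr1 ?normr0. Qed.

Lemma cutoff_bounded N r : 0 < r -> bounded_by (cutoff N r) 1.
Proof.
move=> r0; apply: (inf_convolution_bounded _ (indicator_bounded _)).
by rewrite divr_ge0// ltW.
Qed.

Lemma cutoff_lipschitz N r : 0 < r -> lipschitz_by (cutoff N r) (2 / r).
Proof.
move=> r0; apply: (inf_convolution_lipschitz _ (indicator_bounded _)).
by rewrite divr_ge0// ltW.
Qed.

Lemma cutoff_le N r y : 0 < r ->
  cutoff N r y <= \1_(~` first_balls x N (r / 2)) y.
Proof.
move=> r0; apply: (inf_convolution_le_self _ _ (indicator_bounded _)).
by rewrite divr_ge0// ltW.
Qed.

Lemma cutoff_ge N r y : 0 < r -> \1_(~` first_balls x N r) y <= cutoff N r y.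
Proof.
move=> r0; apply: inf_convolution_ge => z.
have r20 : 0 < 2 / r by rewrite divr_gt0.
have d0 : 0 <= 2 / r * mdist y z by rewrite mulr_ge0 ?mdist_ge0 ?ltW.
rewrite !indicE.
have [yb|ynb] := pselect (first_balls x N r y).
  by rewrite memNset ?addr_ge0// => /(_ yb).
rewrite mem_set//.
have [[i iN zi]|znb] := pselect (first_balls x N (r / 2) z); last first.
  by rewrite mem_set// lerDl.
rewrite memNset ?add0r; last by apply; exists i.
rewrite mulrAC ler_pdivlMr// mul1r leNgt; apply/negP => yz.
apply: ynb; exists i => //.
by rewrite (le_lt_trans (metric_triangle _ z _))// (metric_sym z); lra.
Qed.

End cutoff.

Section closing.
Context {R : realType} {S : completeMetricType R}.

Lemma limn_esup_lt (u : nat -> \bar R) (l : \bar R) :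
  (limn_esup u < l)%E -> \forall n \near \oo, (u n < l)%E.
Proof.
move=> /ereal_inf_lt[_ [A oA <-] uA]; apply: filterS oA => n An.
by apply: le_lt_trans uA; apply: ereal_sup_ubound; exists n.
Qed.

Lemma mean_cvg d0 (T0 : measurableType d0) (P0 : probability T0 R)
    (Y : {RV P0 >-> borel S}) (d : nat -> measure_display)
    (T : forall n, measurableType (d n)) (P : forall n, probability (T n) R)
    (X : forall n, {RV P n >-> borel S}) (f : S -> R) M :
  cvg_in_distribution X Y -> continuous f -> bounded_by f M ->
  \int[P n]_w f (X n w) @[n --> \oo] --> \int[P0]_w f (Y w).
Proof.
move=> XY cf fM.
have bf : bounded_fun f.
  exists M; split; first by rewrite num_real.
  by move=> b Mb y _; exact: le_trans (fM y) (ltW Mb).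
have := XY f cf bf; rewrite (integral_law _ cf fM).
under eq_fun do rewrite (integral_law _ cf fM).
by move/fine_cvg.
Qed.

Lemma cvg_in_distribution_lipschitz d0 (T0 : measurableType d0)
    (P0 : probability T0 R) (Y : {RV P0 >-> borel S}) (d : nat -> measure_display)
    (T : forall n, measurableType (d n)) (P : forall n, probability (T n) R)
    (X : forall n, {RV P n >-> borel S}) :
  (forall f L M, 0 <= L -> lipschitz_by f L -> bounded_by f M ->
    \int[P n]_w f (X n w) @[n --> \oo] --> \int[P0]_w f (Y w)) ->
  cvg_in_distribution X Y.
Proof.
move=> h; apply: weak_cvg_lipschitz => f L M fL fM.
have cf := lipschitz_by_continuous fL.
have E d1 (T1 : measurableType d1) (P1 : probability T1 R)
    (Z : {RV P1 >-> borel S}) :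
    \int[distribution P1 Z]_y f y = \int[P1]_w f (Z w).
  by rewrite {1}/Rintegral (integral_law _ cf fM).
rewrite E; under eq_fun do rewrite E.
apply: (h _ `|L| M) => // y z.
by rewrite (le_trans (fL y z))// ler_wpM2r ?mdist_ge0// ler_norm.
Qed.

Lemma law_first_balls_cvg d0 (T0 : measurableType d0) (P0 : probability T0 R)
    (Y : {RV P0 >-> borel S}) (x : nat -> S) (r e : R) :
  dense_seq x -> 0 < r -> 0 < e ->
  exists N, 1 - e < fine (P0 (Y @^-1` first_balls x N r)).
Proof.
move=> xd r0 e0; pose F N := Y @^-1` first_balls x N r.
have mF N : measurable (F N).
  rewrite -[X in measurable X]setTI.
  exact: measurable_funPT (measurable_first_balls x N r).
have FT : \bigcup_N F N = setT.
  apply/seteqP; split => // w _; have [i yi] := xd (Y w : S) r r0.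
  by exists i.+1 => //; exists i.
have ndF : {homo F : n m / (n <= m)%N >-> (n <= m)%O}.
  move=> n m nm; rewrite subsetEset => w [i iN yi]; exists i => //.
  exact: leq_trans nm.
have := @nondecreasing_cvg_mu _ _ _ P0 F mF; rewrite FT => /(_ measurableT ndF).
rewrite [X in _ --> X]probability_setT => /fine_cvg/cvgrPdist_lt/(_ e e0).
move=> [N _ /(_ N (leqnn N))/=].
by rewrite ltr_norml => /andP[_ h]; exists N; move: h; rewrite /F; lra.
Qed.

End closing.

Section approximating_sequences.
Context {R : realType} {S : completeMetricType R}.
Hypothesis sepS : separable S.
Context (d : nat -> measure_display) (T : forall n, measurableType (d n))
  (P : forall n, probability (T n) R) (X : forall n, {RV (P n) >-> borel S})
  (Xm : forall m n : nat, {RV (P n) >-> borel S})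
  (d' : nat -> measure_display) (T' : forall m, measurableType (d' m))
  (P' : forall m, probability (T' m) R)
  (Xlim : forall m, {RV (P' m) >-> borel S}).
Hypothesis Xm_cvg : forall m, cvg_in_distribution (Xm m) (Xlim m).
Hypothesis X_close : forall eps : R, 0 < eps ->
  limn_esup (fun n => P n [set w | eps <= mdist (X n w : S) (Xm m n w : S)])
    @[m --> \oo] --> 0%E.

Lemma far_probability_small (eps e : R) : 0 < eps -> 0 < e ->
  \forall m \near \oo, \forall n \near \oo,
    fine (P n [set w | eps <= mdist (X n w : S) (Xm m n w : S)]) <= e.
Proof.
move=> eps0 e0.
have near_lt : \forall m \near \oo, (limn_esup (fun n =>
    P n [set w | (eps <= mdist (X n w : S) (Xm m n w : S))%R]) < e%:E)%E.
  apply: (@X_close eps eps0 [set u | (u < e%:E)%E]).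
  by apply: open_ereal_lt'; rewrite lte_fin.
apply: filterS near_lt => m /limn_esup_lt.
apply: filterS => n /ltW h; rewrite -lee_fin fineK// fin_num_measure//.
by apply: measurable_mdist_le.
Qed.

(** The iterated limit is all that is available: how large n must be depends
    on m. *)
Lemma means_close (f : S -> R) (L M e : R) : 0 <= L ->
  lipschitz_by f L -> bounded_by f M -> 0 < e ->
  \forall m \near \oo, \forall n \near \oo,
    `|\int[P n]_w f (X n w) - \int[P n]_w f (Xm m n w)| <= e.
Proof.
move=> L0 fL fM e0.
have M0 : 0 <= M by exact: le_trans (fM point).
have L1 : 0 < L + 1 by rewrite ltr_wpDl.
have M1 : 0 < M + 1 by rewrite ltr_wpDl.
have dL : 0 < e / (L + 1) / 4 by rewrite !divr_gt0.
have dM : 0 < e / (M + 1) / 4 by rewrite !divr_gt0.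
have eL : L * (e / (L + 1) / 4) <= e / 4.
  rewrite [leRHS](_ : _ = (L + 1) * (e / (L + 1) / 4)); last first.
    by field; rewrite gt_eqF.
  by rewrite ler_wpM2r ?ltW// ltrDl.
have eM : M * (e / (M + 1) / 4) <= e / 4.
  rewrite [leRHS](_ : _ = (M + 1) * (e / (M + 1) / 4)); last first.
    by field; rewrite gt_eqF.
  by rewrite ler_wpM2r ?ltW// ltrDl.
apply: filterS (far_probability_small dL dM) => m; apply: filterS => n h.
rewrite (le_trans (dist_mean_le _ _ sepS L0 M0 dL fL fM))//.
have {}h := le_trans (ler_wpM2l M0 h) eM.
by move: h eL; rewrite mulrDl; lra.
Qed.

Variable x : nat -> S.
Hypothesis xd : dense_seq x.

(** Radii are halved twice: from the law of Xlim m to those of Xm m n through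
    cutoff, and from Xm m n to X n by closeness. One good m suffices, so the
    same N serves for all large n. *)
Lemma X_tight (r e : R) : 0 < r -> 0 < e -> exists N, \forall n \near \oo,
  1 - e <= fine (P n (X n @^-1` first_balls x N r)).
Proof.
move=> r0 e0; have r20 : 0 < r / 2 by rewrite divr_gt0.
have r40 : 0 < r / 2 / 2 by rewrite divr_gt0.
have e40 : 0 < e / 4 by rewrite divr_gt0.
(* One quarter of e each: for the mass of Xlim m off the balls, for the limit in n,
   and for the event that X n and Xm m n are far apart. *)
have [m _ /(_ m (leqnn m)) mn] := far_probability_small r20 e40.
have [N hN] := law_first_balls_cvg (Xlim m) xd r40 e40.
exists N; pose phi := cutoff x N (r / 2).
have phiM : bounded_by phi 1 by exact: cutoff_bounded.
have cphi : continuous phi.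
  by apply: lipschitz_by_continuous; exact: cutoff_lipschitz.
have mpre d1 (T1 : measurableType d1) (P1 : probability T1 R)
    (Z : {RV P1 >-> borel S}) s : measurable (Z @^-1` first_balls x N s).
  rewrite -[X in measurable X]setTI.
  exact: measurable_funPT (measurable_first_balls x N s).
have /cvgrPdist_lt/(_ _ e40) := mean_cvg (@Xm_cvg m) cphi phiM.
apply: filterS2 mn => n far.
have iphi d1 (T1 : measurableType d1) (P1 : probability T1 R)
    (Z : {RV P1 >-> borel S}) :
    P1.-integrable [set: T1] (EFin \o (fun w => phi (Z w))).
  apply: (@bounded_by_integrable _ _ _ _ _ 1) => [|w]; last exact: phiM.
  by apply: (measurableT_comp (continuous_borel cphi)).
have out_mean d1 (T1 : measurableType d1) (P1 : probability T1 R)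
    (Z : {RV P1 >-> borel S}) s : 1 - fine (P1 (Z @^-1` first_balls x N s)) =
    \int[P1]_w \1_(~` (Z @^-1` first_balls x N s)) w.
  have mZ := mpre _ _ _ Z s.
  by rewrite Rintegral_indicator ?fine_probability_setC//; exact: measurableC.
have iout d1 (T1 : measurableType d1) (P1 : probability T1 R)
    (Z : {RV P1 >-> borel S}) s : P1.-integrable [set: T1]
    (EFin \o (fun w => \1_(~` (Z @^-1` first_balls x N s)) w : R)).
  by apply: integrable_indicator; apply: measurableC; exact: mpre.
have lo : 1 - fine (P n (Xm m n @^-1` first_balls x N (r / 2))) <=
    \int[P n]_w phi (Xm m n w).
  rewrite out_mean; apply: le_Rintegral => //; [exact: iout|exact: iphi|].
  by move=> w _; exact: (cutoff_ge x N (Xm m n w : S) r20).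
have hi : \int[P' m]_w phi (Xlim m w) <=
    1 - fine (P' m (Xlim m @^-1` first_balls x N (r / 2 / 2))).
  rewrite out_mean; apply: le_Rintegral => //; [exact: iphi|exact: iout|].
  by move=> w _; exact: (cutoff_le x N (Xlim m w : S) r20).
have sub : fine (P n (Xm m n @^-1` first_balls x N (r / 2))) <=
    fine (P n (X n @^-1` first_balls x N r)) +
    fine (P n [set w | r / 2 <= mdist (X n w : S) (Xm m n w : S)]).
  have mfar : measurable [set w | r / 2 <= mdist (X n w : S) (Xm m n w : S)].
    by apply: measurable_mdist_le.
  have mX := mpre _ _ _ (X n) r; have mXm := mpre _ _ _ (Xm m n) (r / 2).
  rewrite -fineD ?fin_num_measure//.
  apply: fine_le; rewrite ?fin_numD ?fin_num_measure//.
  apply: le_trans (measureU2 _ mX mfar).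
  apply: le_measure; rewrite ?inE//; first exact: measurableU mX mfar.
  move=> w [i iN xiw].
  have [|near] := leP (r / 2) (mdist (X n w : S) (Xm m n w : S)); first by right.
  left; exists i => //; rewrite (le_lt_trans (metric_triangle _ (Xm m n w : S) _))//.
  by rewrite (metric_sym (Xm m n w : S)) (splitr r) ltrD.
rewrite /= ltr_norml => /andP[h _].
by move: far lo hi sub hN h; lra.
Qed.

End approximating_sequences.

Theorem theorem2 (R : realType) (S : completeMetricType R)
    (sepS : separable S)
    (d : nat -> measure_display) (T : forall n, measurableType (d n))
    (P : forall n, probability (T n) R)
    (X : forall n, {RV (P n) >-> borel S})
    (Xm : forall m n, {RV (P n) >-> borel S})
    (d' : nat -> measure_display) (T' : forall m, measurableType (d' m))
    (P' : forall m, probability (T' m) R)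
    (Xlim : forall m, {RV (P' m) >-> borel S})
    (Xm_cvg : forall m, cvg_in_distribution (Xm m) (Xlim m))
    (X_close : forall eps : R, 0 < eps ->
       limn_esup (fun n => P n [set w | eps <= mdist (X n w : S) (Xm m n w : S)])
         @[m --> \oo] --> 0%E) :
  exists (d0 : measure_display) (T0 : measurableType d0)
         (P0 : probability T0 R) (X0 : {RV P0 >-> borel S}),
    cvg_in_distribution X X0 /\ cvg_in_distribution Xlim X0.
Proof.
have [x xd] := separable_dense_seq sepS.
have [U [UF ooU]] := ultraFilterLemma eventually_filter.
have tightU (r e : R) : 0 < r -> 0 < e -> exists N, \forall n \near U,
    1 - e <= fine (P n (X n @^-1` first_balls x N r)).
  move=> r0 e0; have [N hN] := X_tight sepS Xm_cvg X_close xd r0 e0.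
  by exists N; exact: ooU.
have [Y YU] := tight_ultralimit UF tightU.
have Xlim_mean f L M : 0 <= L -> lipschitz_by f L -> bounded_by f M ->
    \int[P' m]_w f (Xlim m w) @[m --> \oo] -->
    \int[uniform_prob (@ltr01 R)]_t f (Y t).
  move=> L0 fL fM; apply/cvgrPdist_le => e e0.
  apply: filterS (means_close sepS X_close L0 fL fM e0) => m /ooU close.
  have cm := mean_cvg (@Xm_cvg m) (lipschitz_by_continuous fL) fM.
  (* The bound holds for all large n, so it survives the limit along U. *)
  have cU := cvg_trans (cvg_app _ ooU) cm.
  apply: (cvgr_to_le (cvg_norm (cvgB (YU f L M L0 fL fM) cU))).
  exact: close.
exists _, _, (uniform_prob (@ltr01 R)), Y; split.
  apply: cvg_in_distribution_lipschitz => f L M L0 fL fM.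
  apply/cvgrPdist_lt => e e0; have e40 : 0 < e / 4 by rewrite divr_gt0.
  (* X n, Xm m n, Xlim m, Y: fix m so that the outer two steps are small. *)
  have /cvgrPdist_lt/(_ _ e40) := Xlim_mean f L M L0 fL fM.
  move=> /filterI/(_ (means_close sepS X_close L0 fL fM e40)).
  move=> [m _ /(_ m (leqnn m))[/= h1 h2]].
  have /cvgrPdist_lt/(_ _ e40) :=
    mean_cvg (@Xm_cvg m) (lipschitz_by_continuous fL) fM.
  apply: filterS2 h2 => n /=; move: h1.
  rewrite !ltr_norml ler_norml => /andP[a1 a2] /andP[a3 a4] /andP[a5 a6].
  by apply/andP; split; lra.
by apply: cvg_in_distribution_lipschitz => f L M L0 fL fM; exact: Xlim_mean fL fM.
Qed.
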